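(* For an integer $n\ge1$ let $C_n^*=\big(T_n(2^{1/n})\big)^{1/n}$, where $$ T_n(x)=\sum_{k=0}^{\lfloor n/2\rfloor}\binom{n}{2k}(x^2-1)^kx^{n-2k} $$ is the $n$th Chebyshev polynomial of the first kind. Then, with $\nu=\sqrt{(\log 4)/n}$, as $n\to\infty$, $$ C_n^*=1+\nu-\frac14\nu^3+\frac{5}{96}\nu^5-\frac{1}{128}\nu^7+O(\nu^9). $$ In particular, $(C_n^* )^{\sqrt n}\to e^{\sqrt{\log 4}}$ and $C_n^*\to1$ as $n\to\infty$. *)

(* Defs.v *)
From HB Require Import structures.
From mathcomp Require Import all_boot all_order all_algebra.
From mathcomp Require Import all_classical all_reals all_analysis.

Set Implicit Arguments.
Unset Strict Implicit.
Unset Printing Implicit Defensive.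

Import Order.TTheory GRing.Theory Num.Theory.
Import numFieldNormedType.Exports.

Local Open Scope classical_set_scope.
Local Open Scope ring_scope.

Definition chebyshevT (R : realType) (n : nat) : {poly R} :=
  \sum_(0 <= k < (n %/ 2).+1)
    'C(n, 2 * k)%:R *: (('X^2 - 1) ^+ k * 'X^(n - 2 * k)).

(* Meaningful for [n >= 1]; the value at [n = 0], where [0^-1 = 0], is
   irrelevant to the behaviour as [n] tends to infinity. *)
Definition Cstar (R : realType) (n : nat) : R :=
  (chebyshevT R n).[2 `^ n%:R^-1] `^ n%:R^-1.

Definition nu (R : realType) (n : nat) : R := Num.sqrt (ln 4 / n%:R).

(* Main.v *)
Require Import Defs.
From HB Require Import structures.
From mathcomp Require Import all_boot all_order all_algebra.
From mathcomp Require Import all_classical all_reals all_analysis.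
From mathcomp Require Import ring lra.

Import Order.TTheory GRing.Theory Num.Theory.
Import numFieldNormedType.Exports.

Local Open Scope classical_set_scope.
Local Open Scope ring_scope.

(* Put [u = nu^2 = ln 4 / n] and [x = 2 `^ (1/n) = exp (u / 2)].  Writing
   [T_n(x)] as the mean of [(x + s)^n] and [(x - s)^n], [s = sqrt (x^2 - 1)],
   gives [C_n = (1 + sqrt (1 - exp (- u))) (1 + d)^(1/n)] with
   [d = (x + s)^(-2n)].  Since [x + s >= exp (nu / 2)], [d] decays like
   [exp (- ln 4 / nu)], so the last factor is [1 + O(nu^9)]; the expansion is
   that of [sqrt (1 - exp (- nu^2))] at [nu = 0]. *)

(** * Chebyshev polynomials through the binomial theorem *)

Lemma sum_nat_even (V : nmodType) (F : nat -> V) (n : nat) :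
  \sum_(0 <= i < n | ~~ odd i) F i = \sum_(0 <= k < uphalf n) F (2 * k)%N.
Proof.
elim: n => [|n IHn]; first by rewrite !big_geq.
rewrite big_mkcond big_nat_recr //= -big_mkcond IHn.
have := odd_double_half n; rewrite uphalf_half.
case: (odd n) => /= n2; first by rewrite addr0 add1n.
by rewrite !add0n big_nat_recr //= mul2n [n./2.*2]n2.
Qed.

(** In the binomial expansions the odd powers of [s] cancel and the even ones double, with
    [s ^+ (2 * k)] equal to [(x ^+ 2 - 1) ^+ k]. *)
Lemma chebyshevT_halfsum (R : realType) (n : nat) (x s : R) :
  s ^+ 2 = x ^+ 2 - 1 ->
  (chebyshevT R n).[x] = ((x + s) ^+ n + (x - s) ^+ n) / 2.
Proof.
move=> s2; apply: (canRL (mulfK _)); first by rewrite pnatr_eq0.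
rewrite /chebyshevT horner_sum !exprDn -big_split /=.
pose F i : R := x ^+ (n - i) * s ^+ i *+ 'C(n, i) *+ 2.
transitivity (\sum_(0 <= i < n.+1 | ~~ odd i) F i).
  rewrite sum_nat_even /= -divn2 mulr_suml; apply: eq_bigr => k _.
  rewrite !hornerE -s2 -exprM /= /F -[RHS]mulr_natr -[in RHS]mulr_natl.
  by rewrite -mulrA [s ^+ _ * _]mulrC.
rewrite big_mkcond big_mkord; apply: eq_bigr => i _.
rewrite exprNn -signr_odd /F; case: (odd i) => /=.
  by rewrite expr1 mulN1r mulrN mulNrn subrr.
by rewrite expr0 mul1r mulr2n.
Qed.

(** * Taylor bounds for the exponential and the expansion of the square root *)

Lemma derive_ge0_ge0 (R : realType) (f g : R -> R) :
  (forall x : R, is_derive x 1 f (g x)) -> f 0 = 0 ->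
  (forall x, 0 <= x -> 0 <= g x) -> forall x, 0 <= x -> 0 <= f x.
Proof.
move=> fg f0 g0 x; rewrite le_eqVlt => /predU1P[<-|x0]; first by rewrite f0.
have [|c] := @MVT R f g 0 x x0 (fun y _ => fg y).
  apply: continuous_subspaceT => y.
  by apply/differentiable_continuous/derivable1_diffP; have [] := fg y.
rewrite in_itv /= f0 !subr0 => /andP[c0 _] ->.
by rewrite mulr_ge0 ?g0 // ltW.
Qed.

(* [(-1)^n] times the remainder of order [n] in the Taylor expansion of
   [expR (- u)] at [0]. *)
Fixpoint expN_rem (R : realType) (n : nat) (u : R) : R :=
  if n is m.+1 then u ^+ m / m`!%:R - expN_rem R m u else expR (- u).

(** The alternating sign in [expN_rem] makes each remainder a primitive of the previous one, so
    nonnegativity on [u >= 0] propagates by induction. *)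
Lemma is_derive_expN_rem (R : realType) (n : nat) (u : R) :
  is_derive u 1 (expN_rem R n.+1) (expN_rem R n u).
Proof.
elim: n u => [|n IHn] u.
  have -> : expN_rem R 1 = cst 1 - (expR \o -%R).
    by apply/funext => v; rewrite /= expr0 fact0 divr1.
  by apply: is_derive_eq; rewrite /= mulrN1 opprK add0r.
have -> : expN_rem R n.+2 = (n.+1`!%:R^-1 \*: (id ^+ n.+1)) - expN_rem R n.+1.
  by apply/funext => v; congr (_ - _); rewrite mulrC [in RHS]fctE.
apply: is_derive_eq; rewrite /= /GRing.scale /= mulr1 factS natrM invfM.
by rewrite mulrACA mulVf ?pnatr_eq0 // mul1r mulrC.
Qed.

Lemma expN_rem0 (R : realType) (n : nat) : expN_rem R n.+1 0 = 0.
Proof.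
elim: n => [|n IHn]; first by rewrite /= oppr0 expR0 expr0 fact0 divr1 subrr.
by rewrite [LHS]/= -/(expN_rem R n.+1 0) IHn expr0n mul0r subrr.
Qed.

Lemma expN_rem_ge0 (R : realType) (n : nat) (u : R) :
  0 <= u -> 0 <= expN_rem R n u.
Proof.
elim: n u => [|n IHn] u u0; first exact: expR_ge0.
exact: derive_ge0_ge0 (is_derive_expN_rem R n) (expN_rem0 R n) IHn _ u0.
Qed.

Lemma expN_taylor (R : realType) (u : R) : 0 <= u ->
  0 <= 1 - u + u ^+ 2 / 2 - u ^+ 3 / 6 + u ^+ 4 / 24 - expR (- u)
    <= u ^+ 5 / 120.
Proof.
(* Order 5 gives the lower bound, order 6 the upper one. *)
move=> u0; have := expN_rem_ge0 R 5 u u0; have := expN_rem_ge0 R 6 u u0.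
by rewrite /= !factS fact0 /=; lra.
Qed.

(** The squares of both sides differ by at most [v ^+ 10]; dividing by the sum of the unsquared
    terms, which is at least [v / 2], gives [2 * v ^+ 9]. *)
Lemma sqrt_1BexpN_approx (R : realType) (v : R) : 0 < v <= 1 ->
  `|Num.sqrt (1 - expR (- v ^+ 2))
    - (v - 1 / 4 * v ^+ 3 + 5 / 96 * v ^+ 5 - 1 / 128 * v ^+ 7)|
    <= 2 * v ^+ 9.
Proof.
move=> /andP[v0 v1]; set u := v ^+ 2; set S := Num.sqrt _.
have u0 : 0 <= u by exact: sqr_ge0.
have u1 : u <= 1 by rewrite expr_le1 // ltW.
pose q : R := 1 - 1 / 4 * u + 5 / 96 * u ^+ 2 - 1 / 128 * u ^+ 3.
have -> : v - 1 / 4 * v ^+ 3 + 5 / 96 * v ^+ 5 - 1 / 128 * v ^+ 7 = v * q.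
  rewrite /q /u; ring.
have S2 : S ^+ 2 = 1 - expR (- u).
  by rewrite sqr_sqrtr // subr_ge0 expR_le1 oppr_le0.
have S0 : 0 <= S by exact: sqrtr_ge0.
have u2 : 0 <= u ^+ 2 by exact: sqr_ge0.
have u3 : u ^+ 3 <= 1 by rewrite exprn_ile1.
have q2 : 1 / 2 <= q by rewrite /q; lra.
have vq : v / 2 <= v * q by rewrite ler_wpM2l ?(ltW v0) //; lra.
have key : `|S ^+ 2 - (v * q) ^+ 2| <= u ^+ 5.
  have /andP[t0 t1] := expN_taylor R u u0.
  (* [u ^+ 4 * r] collects the terms of [q ^+ 2] of degree at least 4; the lower ones reproduce the
     Taylor coefficients. *)
  pose r : R := 25 / 9216 + 1 / 256 - 5 / 6144 * u + 1 / 16384 * u ^+ 2.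
  have r01 : 0 <= r <= 1 / 100.
    have u21 : u ^+ 2 <= 1 by rewrite exprn_ile1.
    by rewrite /r; apply/andP; split; lra.
  have u5 : 0 <= u ^+ 5 by rewrite exprn_ge0.
  have /andP[r0 r1] : 0 <= u ^+ 5 * r <= u ^+ 5 * (1 / 100).
    by case/andP: r01 => ? ?; rewrite mulr_ge0 //= ler_wpM2l.
  have -> : (v * q) ^+ 2 =
      u - u ^+ 2 / 2 + u ^+ 3 / 6 - u ^+ 4 / 24 + u ^+ 5 * r.
    by rewrite exprMn -/u /q /r; field.
  by rewrite S2 ler_norml; apply/andP; split; lra.
rewrite -(ler_pM2r (_ : 0 < v / 2)); last by rewrite divr_gt0.
have -> : 2 * v ^+ 9 * (v / 2) = u ^+ 5 by rewrite /u; field.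
apply: le_trans key; rewrite subr_sqr normrM ler_wpM2l //.
by rewrite ger0_norm; lra.
Qed.

(** * Bounds for [n]-th roots, [ln 4] and [nu] *)

Lemma bernoulli_ge (R : realDomainType) (n : nat) (t : R) :
  0 <= t -> 1 + t *+ n <= (1 + t) ^+ n.
Proof.
move=> t0; elim: n => [|n IHn]; first by rewrite mulr0n addr0 expr0.
rewrite exprSr; apply: (@le_trans _ _ ((1 + t *+ n) * (1 + t))).
  have : 0 <= t *+ n * t by rewrite mulr_ge0 // mulrn_wge0.
  by rewrite mulrSr; lra.
by rewrite ler_wpM2r // addr_ge0.
Qed.

(** The upper bound is the [n]-th root of Bernoulli's inequality at [d / n%:R]. *)
Lemma powR_invn_le (R : realType) (n : nat) (d : R) :
  (0 < n)%N -> 0 <= d -> 1 <= (1 + d) `^ n%:R^-1 <= 1 + d / n%:R.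
Proof.
move=> n0 d0; have nR0 : n%:R != 0 :> R by rewrite pnatr_eq0 -lt0n.
have dn0 : 0 <= d / n%:R by rewrite divr_ge0.
have n1 : 0 <= n%:R^-1 :> R by rewrite invr_ge0.
apply/andP; split.
  by rewrite -[leLHS](powRr0 (1 + d)) ler_powR // lerDl.
apply: (@le_trans _ _ (((1 + d / n%:R) ^+ n) `^ n%:R^-1)); last first.
  rewrite -powR_mulrn ?addr_ge0 // -powRrM mulfV // powRr1 //.
  by rewrite addr_ge0.
apply: ge0_ler_powR => //; rewrite ?nnegrE ?addr_ge0 ?exprn_ge0 ?addr_ge0 //.
by apply: le_trans (bernoulli_ge _ n _ dn0); rewrite -[_ *+ n]mulr_natr divfK.
Qed.

Lemma ln4E (R : realType) : ln 4 = 2 * ln 2 :> R.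
Proof.
by rewrite (_ : 4 = 2 ^+ 2) ?lnXn // ?mulr_natl //; ring.
Qed.

Lemma ln4_le2 (R : realType) : ln 4 <= 2 :> R.
Proof.
rewrite ln4E -[leRHS]mulr1 ler_pM2l //.
have := @le_ln1Dx R 1; rewrite (_ : 1 + 1 = 2 :> R); last by [].
by apply; lra.
Qed.

(** From [expR (- 2^-1) >= 1 / 2], the square root of [e] is at most 2. *)
Lemma ln4_ge1 (R : realType) : 1 <= ln 4 :> R.
Proof.
rewrite -ler_expR lnK ?posrE //.
have := @expR_ge1Dx R (- 2^-1); rewrite expRN => h.
have e0 := @expR_gt0 R (2^-1).
have e2 : expR (2^-1) <= 2 :> R.
  rewrite -lef_pV2 ?posrE //; lra.
have -> : expR 1 = expR 2^-1 ^+ 2 :> R by rewrite -expRM_natl mulfV.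
rewrite (_ : 4 = 2 ^+ 2); last by ring.
by rewrite lerXn2r ?nnegrE // ltW.
Qed.

Lemma sqr_nu (R : realType) (n : nat) : nu R n ^+ 2 = ln 4 / n%:R.
Proof.
by rewrite sqr_sqrtr // divr_ge0 // (le_trans _ (ln4_ge1 R)).
Qed.

Lemma nu_gt0_le1 (R : realType) (n : nat) : (1 < n)%N -> 0 < nu R n <= 1.
Proof.
move=> n1; have n0 : 0 < n%:R :> R by rewrite ltr0n ltnW.
have l1 := ln4_ge1 R; have l2 := ln4_le2 R.
rewrite sqrtr_gt0 divr_gt0 ?(lt_le_trans _ l1) //=.
rewrite -sqrtr1 ler_wsqrtr // ler_pdivrMr // mul1r (le_trans l2) //.
by rewrite ler_nat.
Qed.

(* With [x = 2 `^ (1/n)] and [y = x + sqrt (x^2 - 1)], the value of the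
   Chebyshev polynomial is [y^n (1 + d) / 2] for [d = y^(-2n)], and the factor
   [2 `^ (-1/n)] produced by the [n]-th root is exactly [1/x]. *)
Lemma Cstar_factor (R : realType) (n : nat) : (1 < n)%N ->
  exists2 d : R, 0 <= d <= 7`!%:R * nu R n ^+ 7 &
    Cstar R n = (1 + Num.sqrt (1 - expR (- nu R n ^+ 2))) *
                (1 + d) `^ n%:R^-1.
Proof.
move=> n1; have n0 : 0 < n%:R :> R by rewrite ltr0n ltnW.
have nN0 : n%:R != 0 :> R by rewrite gt_eqF.
have /andP[v0 v1] := nu_gt0_le1 R n n1; have := sqr_nu R n.
rewrite /Cstar; set v := nu R n in v0 v1 * => v2.
set x := 2 `^ n%:R^-1.
have xE : x = expR (v ^+ 2 / 2).
  by rewrite v2 ln4E /x /powR pnatr_eq0 /=; congr expR; field.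
have x2 : x ^+ 2 = expR (v ^+ 2).
  by rewrite xE -expRM_natl; congr expR; field.
have x0 : 0 < x by rewrite xE expR_gt0.
have x1 : 1 <= x by rewrite xE -expR0 ler_expR divr_ge0 // sqr_ge0.
pose s := Num.sqrt (x ^+ 2 - 1).
have vx : v ^+ 2 <= x ^+ 2 - 1 by rewrite x2 lerBrDl expR_ge1Dx.
have xge0 : 0 <= x ^+ 2 - 1 by rewrite (le_trans _ vx) // sqr_ge0.
have s2 : s ^+ 2 = x ^+ 2 - 1 by rewrite sqr_sqrtr.
have vs : v <= s by rewrite -(ger0_norm (ltW v0)) -sqrtr_sqr ler_wsqrtr.
have s0 : 0 <= s by exact: sqrtr_ge0.
pose y := x + s; have y0 : 0 < y by rewrite ltr_wpDr.
have yN0 : y != 0 by rewrite gt_eqF.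
have xsE : x - s = y^-1.
  apply: (mulfI yN0); rewrite mulfV // /y mulrC -subr_sqr s2; ring.
(* Since [v <= 1], [expR (v / 2) <= (1 - v / 2)^-1 <= 1 + v]. *)
have ve : expR (v / 2) <= 1 + v.
  have := @expR_ge1Dx R (- (v / 2)); rewrite expRN.
  have := @expR_gt0 R (v / 2); set e := expR _ => e0 he.
  have h1 : 1 <= (1 + v) * (1 - v / 2) by nra.
  have h2 : (1 + v) * (1 - v / 2) <= (1 + v) / e by rewrite ler_wpM2l //; lra.
  by have := le_trans h1 h2; rewrite ler_pdivlMr // mul1r.
have ye : expR (v / 2) <= y by rewrite (le_trans ve) // lerD.
exists (y ^- (2 * n)).
  rewrite invr_ge0 exprn_ge0 ?(ltW y0) //=.
  (* As [n%:R * v = ln 4 / v >= v^-1], [y ^+ (2 * n)] dominates [expR v^-1], hence the degree 7 term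
     of its series. Degree 7 suffices: the [n]-th root contributes two more powers of [v]. *)
  have h : expR (n%:R * v) <= y ^+ (2 * n).
    rewrite (_ : n%:R * v = (2 * n)%:R * (v / 2)); last by rewrite natrM; field.
    by rewrite expRM_natl lerXn2r // nnegrE ?expR_ge0 // ltW.
  have nv : v^-1 <= n%:R * v.
    rewrite -[leLHS]mul1r ler_pdivrMr // -mulrA -expr2 v2 mulrCA mulfV //.
    by rewrite mulr1 ln4_ge1.
  have vi : 0 <= v^-1 by rewrite invr_ge0 ltW.
  have h7 : v^-1 ^+ 7 / 7`!%:R <= y ^+ (2 * n).
    apply: le_trans h; apply: (@le_trans _ _ (expR v^-1)).
      apply: le_trans (@expR_ge1Dxn R v^-1 6 vi).
      by rewrite lerDr.
    by rewrite ler_expR.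
  have f0 : 0 < 7`!%:R :> R by rewrite ltr0n fact_gt0.
  have w0 : 0 < v^-1 ^+ 7 / 7`!%:R by rewrite divr_gt0 ?exprn_gt0 ?invr_gt0.
  have Y0 : 0 < y ^+ (2 * n) by rewrite exprn_gt0.
  have -> : 7`!%:R * v ^+ 7 = (v^-1 ^+ 7 / 7`!%:R)^-1.
    by rewrite invfM invrK exprVn invrK mulrC.
  by rewrite lef_pV2.
rewrite (chebyshevT_halfsum _ _ _ _ s2) xsE -/y exprVn.
have -> : (y ^+ n + y ^- n) / 2 = y ^+ n * 2^-1 * (1 + y ^- (2 * n)).
  have : y ^+ n != 0 by rewrite expf_neq0.
  by rewrite mulnC exprM => ?; field.
have d0 : 0 <= y ^- (2 * n) by rewrite invr_ge0 exprn_ge0 // ltW.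
rewrite powRM ?addr_ge0 ?mulr_ge0 ?exprn_ge0 ?(ltW y0) //; congr (_ * _).
rewrite powRM ?exprn_ge0 ?(ltW y0) // -powR_mulrn ?(ltW y0) // -powRrM.
rewrite mulfV // powRr1 ?(ltW y0) //.
rewrite -[2^-1]powR_inv1 // -powRrM mulN1r powRN -/x.
(* Now [y / x = 1 + s / x], and the square of [s / x] is [1 - x ^- 2]. *)
rewrite /y mulrDl mulfV ?gt_eqF //; congr (1 + _).
rewrite -[LHS]ger0_norm ?divr_ge0 ?(ltW x0) // -sqrtr_sqr; congr Num.sqrt.
by rewrite exprMn s2 exprVn mulrBl mulfV ?mul1r ?expf_neq0 ?gt_eqF // x2 expRN.
Qed.

(** * Explicit error bounds for [Cstar] *)

Lemma Cstar_approx (R : realType) (n : nat) : (1 < n)%N ->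
  `|Cstar R n - (1 + nu R n - 1 / 4 * nu R n ^+ 3
      + 5 / 96 * nu R n ^+ 5 - 1 / 128 * nu R n ^+ 7)|
    <= (2 * 7`!%:R + 2) * nu R n ^+ 9.
Proof.
move=> n1; have n0 : 0 < n%:R :> R by rewrite ltr0n ltnW.
have [d /andP[d0 d7] ->] := Cstar_factor R n n1.
have vP := nu_gt0_le1 R n n1; have /andP[v0 v1] := vP.
have := sqrt_1BexpN_approx R _ vP; have := sqr_nu R n.
set v := nu R n in d7 v0 v1 vP *; set S := Num.sqrt _; set p := v - _ + _ - _.
move=> v2 Sp; have -> : 1 + v - 1 / 4 * v ^+ 3 + 5 / 96 * v ^+ 5
    - 1 / 128 * v ^+ 7 = 1 + p by rewrite !addrA.
have S01 : 0 <= S <= 1.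
  by rewrite sqrtr_ge0 -[leRHS]sqrtr1 ler_wsqrtr // lerBlDr lerDl.
have := powR_invn_le R n d (ltnW n1) d0; set w := _ `^ _ => /andP[w1 wd].
(* Here [ln 4 >= 1] gives [n%:R^-1 <= v ^+ 2]. *)
have dn : d / n%:R <= 7`!%:R * v ^+ 9.
  have -> : 7`!%:R * v ^+ 9 = 7`!%:R * v ^+ 7 * v ^+ 2 by rewrite -mulrA -exprD.
  apply: ler_pM; rewrite ?invr_ge0 ?(ltW n0) // v2 -[leLHS]mul1r.
  by rewrite ler_wpM2r ?ln4_ge1 // invr_ge0 ltW.
have -> : (1 + S) * w - (1 + p) = (1 + S) * (w - 1) + (S - p) by ring.
have -> : (2 * 7`!%:R + 2) * v ^+ 9 = 2 * (7`!%:R * v ^+ 9) + 2 * v ^+ 9 by ring.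
rewrite (le_trans (ler_normD _ _)) // lerD //.
by rewrite ger0_norm ?mulr_ge0 ?ler_pM //; lra.
Qed.

Lemma Cstar_first_order (R : realType) (n : nat) : (1 < n)%N ->
  `|Cstar R n - 1 - nu R n| <= (2 * 7`!%:R + 3) * nu R n ^+ 3.
Proof.
move=> n1; have := Cstar_approx R n n1; have /andP[v0 v1] := nu_gt0_le1 R n n1.
set K := 2 * _; set v := nu R n in v0 v1 *; set c := Cstar R n.
have K0 : 0 <= K by rewrite mulr_ge0.
have v3 (k : nat) : 0 <= v ^+ (k + 3) <= v ^+ 3.
  rewrite exprD mulr_ge0 ?exprn_ge0 ?(ltW v0) //= -[leRHS]mul1r.
  by rewrite ler_wpM2r ?exprn_ge0 ?exprn_ile1 // ltW.
have /andP[a0 a1] := v3 0%N; have /andP[b0 b1] := v3 2%N.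
have /andP[c0 c1] := v3 4%N; have /andP[d0 d1] := v3 6%N.
have : (K + 2) * v ^+ 9 <= (K + 2) * v ^+ 3 by rewrite ler_wpM2l // addr_ge0.
(* The extra [v ^+ 3] absorbs the three correction terms, whose coefficients have absolute values
   summing to less than 1. *)
have -> : (K + 3) * v ^+ 3 = (K + 2) * v ^+ 3 + v ^+ 3 by ring.
move: ((K + 2) * v ^+ 3) ((K + 2) * v ^+ 9) => P Q PQ.
by rewrite !ler_norml => /andP[l r]; apply/andP; split; lra.
Qed.

Lemma Cstar_ge1 (R : realType) (n : nat) : (1 < n)%N -> 1 <= Cstar R n.
Proof.
move=> n1; have [d /andP[d0 _] ->] := Cstar_factor R n n1.
have /andP[w1 _] := powR_invn_le R n d (ltnW n1) d0.
by rewrite -[leLHS]mulr1 ler_pM // lerDl sqrtr_ge0.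
Qed.

(** * Limits *)

Lemma cvg_nu (R : realType) : nu R @ \oo --> (0 : R).
Proof.
have h : (fun n : nat => ln 4 / n%:R) @ \oo --> (0 : R).
  (* The harmonic sequence is [n.+1%:R^-1], hence the shift. *)
  rewrite -[X in _ --> X](mulr0 (ln 4 : R)); apply: cvgMl_tmp.
  by rewrite -cvg_shiftS; exact: cvg_harmonic.
rewrite -[X in _ --> X]sqrtr0.
by apply: continuous_cvg h; exact: sqrt_continuous.
Qed.

Lemma sqrtn_nu (R : realType) (n : nat) : (0 < n)%N ->
  Num.sqrt n%:R * nu R n = Num.sqrt (ln 4).
Proof.
move=> n0; rewrite -sqrtrM // mulrC divfK // pnatr_eq0.
by rewrite -lt0n.
Qed.

Lemma ln_ge_1BV (R : realType) (x : R) : 0 < x -> 1 - x^-1 <= ln x.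
Proof.
move=> x0; have := @le_ln1Dx R (x^-1 - 1).
rewrite [1 + _]addrC subrK lnV ?posrE // => h.
have xi : 0 < x^-1 by rewrite invr_gt0.
have : - ln x <= x^-1 - 1 by apply: h; lra.
lra.
Qed.

Lemma cvg_Cstar_slope (R : realType) :
  (fun n => (Cstar R n - 1) / nu R n) @ \oo --> (1 : R).
Proof.
pose K : R := 2 * 7`!%:R + 3.
have K0 : (fun n => K * (nu R n * nu R n)) @ \oo --> (0 : R).
  rewrite -[X in _ --> X](mulr0 K) -[X in K * X](mulr0 0).
  by apply: cvgMl_tmp; apply: cvgM; exact: cvg_nu.
apply: (cvg_sub0 _ (cvg_cst (1 : R))).
apply: norm_cvg0; apply: squeeze_cvgr (@cvg_cst _ (0 : R) _ \oo _) K0.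
near=> n; have n1 : (1 < n)%N by near: n; exact: nbhs_infty_gt.
have /andP[v0 _] := nu_gt0_le1 R n n1.
rewrite normr_ge0 /= -(ler_pM2r v0) -[X in _ * X <= _](gtr0_norm v0) -normrM.
rewrite !fctE mulrBl mul1r divfK ?gt_eqF // -!mulrA -expr2 -exprS.
exact: Cstar_first_order.
Unshelve. all: by end_near. Qed.

Lemma cvg_Cstar (R : realType) : Cstar R @ \oo --> (1 : R).
Proof.
have h : (fun n => 1 + (Cstar R n - 1) / nu R n * nu R n) @ \oo --> (1 : R).
  rewrite -[X in _ --> X]addr0 -[X in 1 + X](mulr0 1).
  apply: cvgD; first exact: cvg_cst.
  exact: cvgM (cvg_Cstar_slope R) (cvg_nu R).
apply: cvg_trans h; apply: near_eq_cvg.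
near=> n; have n1 : (1 < n)%N by near: n; exact: nbhs_infty_gt.
have /andP[v0 _] := nu_gt0_le1 R n n1.
by rewrite divfK ?gt_eqF // addrC subrK.
Unshelve. all: by end_near. Qed.

(** Squeeze using [1 - c^-1 <= ln c <= c - 1] at [c = Cstar R n]: the two bounds divided by [nu]
    differ by the factor [c^-1], which tends to 1. *)
Lemma cvg_ln_Cstar_slope (R : realType) :
  (fun n => ln (Cstar R n) / nu R n) @ \oo --> (1 : R).
Proof.
have h1 := cvg_Cstar_slope R.
have h2 : (fun n => (Cstar R n - 1) / nu R n * (Cstar R n)^-1) @ \oo --> (1 : R).
  rewrite -[X in _ --> X]mulr1 -[X in _ * X]invr1.
  by apply: cvgM h1 _; apply: cvgV (cvg_Cstar R); rewrite oner_eq0.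
apply: squeeze_cvgr h2 h1.
near=> n; have n1 : (1 < n)%N by near: n; exact: nbhs_infty_gt.
have /andP[v0 _] := nu_gt0_le1 R n n1; have c1 := Cstar_ge1 R n n1.
have c0 : 0 < Cstar R n by rewrite (lt_le_trans _ c1).
have vi : 0 < (nu R n)^-1 by rewrite invr_gt0.
rewrite mulrAC !(ler_pM2r vi) mulrBl mulfV ?gt_eqF // mul1r ln_ge_1BV //=.
have := @le_ln1Dx R (Cstar R n - 1); rewrite [1 + _]addrC subrK; apply; lra.
Unshelve. all: by end_near. Qed.

Theorem theorem2 (R : realType) :
  [/\ Cstar R =
        (fun n : nat => 1 + nu R n - 1 / 4 * nu R n ^+ 3
          + 5 / 96 * nu R n ^+ 5 - 1 / 128 * nu R n ^+ 7)
        +O_\oo (fun n : nat => nu R n ^+ 9),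
      (fun n : nat => Cstar R n `^ Num.sqrt n%:R) @ \oo
        --> expR (Num.sqrt (ln 4)) &
      Cstar R @ \oo --> (1 : R)].
Proof.
split; last exact: cvg_Cstar.
  apply/eqaddOP/bigO_exP; exists (2 * 7`!%:R + 2).
    by rewrite ltr_wpDl // mulr_ge0.
  near=> n; have n1 : (1 < n)%N by near: n; exact: nbhs_infty_gt.
  have /andP[v0 _] := nu_gt0_le1 R n n1.
  rewrite [`|nu R n ^+ 9|]ger0_norm ?exprn_ge0 ?(ltW v0) //.
  exact: Cstar_approx.
(* This is the power rewritten with [Num.sqrt n%:R = Num.sqrt (ln 4) / nu R n], valid once
   [n > 1]. *)
have h : (fun n => expR (Num.sqrt (ln 4) * (ln (Cstar R n) / nu R n))) @ \oo
    --> expR (Num.sqrt (ln 4)).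
  apply: continuous_cvg; first exact: continuous_expR.
  rewrite -[X in _ --> X]mulr1.
  exact: cvgMl_tmp (cvg_ln_Cstar_slope R).
apply: cvg_trans h; apply: near_eq_cvg.
near=> n; have n1 : (1 < n)%N by near: n; exact: nbhs_infty_gt.
have /andP[v0 _] := nu_gt0_le1 R n n1; have c1 := Cstar_ge1 R n n1.
rewrite /powR gt_eqF ?(lt_le_trans _ c1) // -(sqrtn_nu R n (ltnW n1)).
by congr expR; rewrite -mulrA; congr (_ * _); rewrite mulrC divfK ?gt_eqF.
Unshelve. all: by end_near. Qed.
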